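(* Let $D$ be an integral domain with the $t$-finite character. Then each faithfully flat ideal of $D$ is invertible.
   Context: $D$ is an integral domain with quotient field $K$. ''Ideal of $D$'' means fractional ideal: a $D$-submodule $I$ of $K$ with $dI\subseteq D$ for some nonzero $d\in D$. An ideal is faithfully flat if it is faithfully flat as a $D$-module. For $D$-submodules $A,B$ of $K$, $(A:B)=\{x\in K\mid xB\subseteq A\}$. An ideal $I$ is invertible if $I\,(D:I)=D$. For a nonzero ideal $J$, $J_v=(D:(D:J))$, and for a nonzero ideal $I$, $I_t=\bigcup J_v$, where the union is over all nonzero finitely generated $D$-submodules $J$ of $K$ with $J\subseteq I$. A nonzero ideal $I$ is a $t$-ideal if $I=I_t$. A $t$-maximal ideal is an ideal maximal in the set of proper $t$-ideals of $D$ (those properly contained in $D$). $D$ has the $t$-finite character if each proper $t$-ideal (nonzero, properly contained in $D$) is contained in only finitely many $t$-maximal ideals. *)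

(* Defs.v *)
From HB Require Import structures.
From mathcomp Require Import all_boot all_order all_algebra.
From mathcomp Require Import generic_quotient ring_quotient fraction freeg.
From mathcomp Require Import mathcomp_extra boolp classical_sets functions.
From mathcomp Require Import cardinality.

Set Implicit Arguments.
Unset Strict Implicit.
Unset Printing Implicit Defensive.

Import GRing.Theory.
Local Open Scope ring_scope.
Local Open Scope classical_set_scope.
Local Open Scope quotient_scope.

Section Tensor.
Variables (R : comNzRingType) (M N : lmodType R).

Definition tensor_relators : set {freeg (M * N) / int} :=
  [set r | exists m m' n, r = << (m + m', n) >> - << (m, n) >> - << (m', n) >>]
  `|` [set r | exists m n n',
         r = << (m, n + n') >> - << (m, n) >> - << (m, n') >>]
  `|` [set r | exists a m n, r = << (a *: m, n) >> - << (m, a *: n) >>].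

Definition tensor_kernel : set {freeg (M * N) / int} :=
  smallest [set A | zmod_closed (mem A)] tensor_relators.

Definition tensor_kernel_pred : {pred {freeg (M * N) / int}} :=
  fun x => x \in tensor_kernel.

Lemma tensor_kernel_closed : zmod_closed tensor_kernel_pred.
Proof.
split; first by apply/mem_set => A [[]] /set_mem.
move=> x y /set_mem xK /set_mem yK; apply/mem_set => A AP.
have [[_ AB] _] := AP.
by apply/set_mem/AB; apply/mem_set; [exact: xK | exact: yK].
Qed.

HB.instance Definition _ :=
  GRing.isZmodClosed.Build _ tensor_kernel_pred tensor_kernel_closed.

(* The tensor product over R: the free abelian group on M * N modulo the
   relations of bilinearity. Exactness only involves its additive group, so the
   R-module structure is left out. *)
Definition tensor := Quotient.quot tensor_kernel_pred.

HB.instance Definition _ := ZmodQuotient.on tensor.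

Definition pure_tensor (m : M) (n : N) : tensor := \pi << (m, n) >>.

Lemma eq_tensor x y : x - y \in tensor_kernel -> x = y %[mod tensor].
Proof. by move=> xy; apply/eqP; rewrite -Quotient.idealrBE. Qed.

End Tensor.

Section TensorMap.
Variables (R : comNzRingType) (M N N' : lmodType R).

Definition freeg_map (f : N -> N') :
    {freeg (M * N) / int} -> {freeg (M * N') / int} :=
  fglift (fun p => << (p.1, f p.2) >>).

(* The map sending m (x) n to m (x) f n; see tensor_map_is_zmod_morphism and
   tensor_map_pure below. *)
Definition tensor_map (f : N -> N') (t : tensor M N) : tensor M N' :=
  \pi_(tensor M N') (freeg_map f (repr t)).

Variable f : {linear N -> N'}.

Lemma freeg_map_pure m n : freeg_map f << (m, n) >> = << (m, f n) >>.
Proof. by rewrite /freeg_map liftU scale1r. Qed.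

Lemma freeg_mapB x y : freeg_map f (x - y) = freeg_map f x - freeg_map f y.
Proof. exact: lift_is_additive. Qed.

Lemma freeg_map_kernel x :
  x \in @tensor_kernel R M N -> freeg_map f x \in @tensor_kernel R M N'.
Proof.
move=> /set_mem xK.
apply: (xK [set y | freeg_map f y \in @tensor_kernel R M N']).
have [K0 KB] := @tensor_kernel_closed R M N'.
split.
- split; first by apply/mem_set => /=; rewrite -(subrr 0) freeg_mapB subrr.
  move=> u v /set_mem /= uK /set_mem /= vK; apply/mem_set => /=.
  by rewrite freeg_mapB; exact: KB.
- move=> y yrel /=; apply/mem_set => A [_]; apply.
  case: yrel => [[[m [m' [n ->]]]|[m [n [n' ->]]]]|[a [m [n ->]]]];
    rewrite !freeg_mapB !freeg_map_pure ?linearD ?linearZ /=.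
  + by left; left; exists m, m', (f n).
  + by left; right; exists m, (f n), (f n').
  + by right; exists a, m, (f n).
Qed.

Lemma tensor_map_pi x : tensor_map f (\pi_(tensor M N) x) = \pi_(tensor M N') (freeg_map f x).
Proof.
apply: eq_tensor; rewrite -freeg_mapB; apply: freeg_map_kernel.
have : repr (\pi_(tensor M N) x) = x %[mod tensor M N] by rewrite reprK.
by move/eqP; rewrite -Quotient.idealrBE.
Qed.

Lemma tensor_map_pure m n :
  tensor_map f (pure_tensor m n) = pure_tensor m (f n).
Proof. by rewrite tensor_map_pi freeg_map_pure. Qed.

Lemma tensor_map_is_zmod_morphism : zmod_morphism (tensor_map f).
Proof.
move=> x y; rewrite -[x]reprK -[y]reprK -raddfB !tensor_map_pi -raddfB.
by rewrite freeg_mapB.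
Qed.

End TensorMap.

Definition exact_at (U V W : zmodType) (f : U -> V) (g : V -> W) :=
  range f = g @^-1` [set 0].

Definition faithfully_flat (R : comNzRingType) (M : lmodType R) :=
  forall (N' N N'' : lmodType R) (f : {linear N' -> N}) (g : {linear N -> N''}),
    exact_at f g <-> exact_at (@tensor_map R M _ _ f) (@tensor_map R M _ _ g).

Section QuotientField.
Variable D : idomainType.
Local Notation K := {fraction D}.

Definition frac_scale (a : D) (x : K) : K := FracField.tofrac a * x.

Lemma frac_scaleA a b x : frac_scale a (frac_scale b x) = frac_scale (a * b) x.
Proof. by rewrite /frac_scale mulrA rmorphM. Qed.

Lemma frac_scale1 : left_id 1 frac_scale.
Proof. by move=> x; rewrite /frac_scale rmorph1 mul1r. Qed.

Lemma frac_scaleDr : right_distributive frac_scale +%R.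
Proof. by move=> a x y; rewrite /frac_scale mulrDr. Qed.

Lemma frac_scaleDl x : {morph frac_scale^~ x : a b / a + b}.
Proof. by move=> a b; rewrite /frac_scale rmorphD mulrDl. Qed.

HB.instance Definition _ := GRing.Zmodule_isLmodule.Build D K
  frac_scaleA frac_scale1 frac_scaleDr frac_scaleDl.

Definition base_ring : set K := range (@FracField.tofrac D).

Definition is_submodule (A : set K) : Prop := submod_closed (mem A).

Definition is_frac_ideal (A : set K) : Prop :=
  is_submodule A /\ exists2 d : D, d != 0 & forall x, A x -> base_ring (d *: x).

Definition gen_submodule (X : set K) : set K := smallest is_submodule X.

Definition colon (A B : set K) : set K := [set x | forall y, B y -> A (x * y)].

Definition ideal_mul (A B : set K) : set K :=
  gen_submodule [set x | exists a b, [/\ A a, B b & x = a * b]].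

Definition invertible (I : set K) : Prop := ideal_mul I (colon base_ring I) = base_ring.

Definition v_closure (J : set K) : set K := colon base_ring (colon base_ring J).

Definition is_fg (J : set K) : Prop := exists2 X, finite_set X & J = gen_submodule X.

Definition t_closure (I : set K) : set K :=
  \bigcup_(J in [set J | [/\ is_fg J, J <> [set 0] & J `<=` I]]) v_closure J.

Definition is_t_ideal (I : set K) : Prop :=
  [/\ is_frac_ideal I, I <> [set 0] & I = t_closure I].

Definition proper_t_ideal (I : set K) : Prop := is_t_ideal I /\ I `<` base_ring.

Definition t_maximal (M : set K) : Prop :=
  proper_t_ideal M /\
  forall N, proper_t_ideal N -> M `<=` N -> N = M.

Definition t_finite_character : Prop :=
  forall I, proper_t_ideal I -> finite_set [set M | t_maximal M /\ I `<=` M].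

Record frac_ideal := FracIdeal {
  ideal_set :> set K;
  ideal_setP : is_frac_ideal ideal_set }.

Definition ideal_pred (I : frac_ideal) : {pred K} := fun x => x \in ideal_set I.

Lemma ideal_pred_closed I : submod_closed (ideal_pred I).
Proof. by have [AS _] := ideal_setP I; exact: AS. Qed.

HB.instance Definition _ (I : frac_ideal) :=
  GRing.isSubmodClosed.Build D K (ideal_pred I) (ideal_pred_closed I).

Definition ideal_module (I : frac_ideal) := {x : K | x \in ideal_pred I}.

HB.instance Definition _ (I : frac_ideal) := SubChoice.on (ideal_module I).
HB.instance Definition _ (I : frac_ideal) :=
  [SubChoice_isSubLmodule of ideal_module I by <:].

End QuotientField.

(* Main.v *)
Require Import Defs.
From HB Require Import structures.
From mathcomp Require Import all_boot all_order all_algebra.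
From mathcomp Require Import generic_quotient fraction freeg.
From mathcomp Require Import boolp classical_sets cardinality.

(** Write PM for the subgroup of M generated by the products s *: m with s in
    P. Faithful flatness of M is used twice.

    - Faithfulness ([faithfully_flat_unit]): a proper ideal P satisfies
      PM <> M, since PM = M says that M (x) P -> M (x) D -> 0 is exact, which
      forces P -> D -> 0 to be exact.
    - Flatness ([flat_relations]): if m is a solution in M of a linear system
      with coefficients in D, then each m_i lies in P_i M, where P_i is the set
      of i-th coordinates of the solutions in D. For M = I this gives, for each
      finite X in I and each a in I, that a belongs to PI with P the ideal of
      all s in D such that sX is contained in aD ([flat_colon]).

    For a single y, combining the two shows that at each proper ideal Q there
    is an a in I such that every y in I has a multiple by an element outside Q
    in aD ([locally_principal]).

    The t-finite character makes this uniform ([colon_finite]). Fix d <> 0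
    with dI in D, x <> 0 in I, and e = dx. Only finitely many t-maximal ideals
    contain e; let X consist of x and of the local generators of I at these
    ideals, and J be the module that X generates. For y in I the ideal (J : y)
    of D contains e, as ey = (dy)x, and is contained in no t-maximal ideal, by
    the choice of X. Hence 1 lies in its t-closure ([t_maximal_exists]), and
    this gives (D : J) = (D : I).

    To conclude, let N = I(D : I) and let a <> 0 be in I. If sX is contained
    in aD then s/a is in (D : J) = (D : I), so s is in N; since a lies in PI
    for the ideal P of these s, a lies in NI. So NI = I, and N = D by
    faithfulness. *)

Set Implicit Arguments.
Unset Strict Implicit.
Unset Printing Implicit Defensive.

Import GRing.Theory.
Local Open Scope ring_scope.
Local Open Scope classical_set_scope.
Local Open Scope quotient_scope.

Local Notation "x %:F" := (@FracField.tofrac _ x).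

(** * Tensor products *)

Lemma freeg_zmod_ind (T : choiceType) (P : set {freeg T / int}) :
    P 0 -> (forall x y, P x -> P y -> P (x - y)) -> (forall t, P << t >>) ->
  forall x, P x.
Proof.
move=> P0 PB P1 x.
have PN y : P y -> P (- y) by move=> Py; rewrite -sub0r; exact: PB.
have PD y z : P y -> P z -> P (y + z).
  by move=> Py Pz; rewrite -[z]opprK; apply: PB => //; exact: PN.
have Pn t n : P (<< t >> *+ n).
  by elim: n => [|n IHn]; rewrite ?mulr0n// mulrS; exact: PD.
rewrite -[x]freeg_sumE; elim/big_ind : _ => // t _.
rewrite -[coeff t x]intz -freegU_mulz.
by case: (coeff t x) => n /=; [exact: Pn | exact/PN/Pn].
Qed.

Section TensorProduct.
Variables (R : comNzRingType) (M N : lmodType R).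

Lemma relator_kernel r :
  @tensor_relators R M N r -> r \in @tensor_kernel_pred R M N.
Proof. by move=> rr; apply/mem_set => A [_]; exact. Qed.

Lemma pure_tensorDl (m m' : M) (n : N) :
  pure_tensor (m + m') n = pure_tensor m n + pure_tensor m' n.
Proof.
rewrite /pure_tensor -raddfD; apply: eq_tensor; rewrite opprD addrA.
by apply: relator_kernel; left; left; exists m, m', n.
Qed.

Lemma pure_tensorDr (m : M) (n n' : N) :
  pure_tensor m (n + n') = pure_tensor m n + pure_tensor m n'.
Proof.
rewrite /pure_tensor -raddfD; apply: eq_tensor; rewrite opprD addrA.
by apply: relator_kernel; left; right; exists m, n, n'.
Qed.

Lemma pure_tensorZ (a : R) (m : M) (n : N) :
  pure_tensor (a *: m) n = pure_tensor m (a *: n).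
Proof. by apply: eq_tensor; apply: relator_kernel; right; exists a, m, n. Qed.

Lemma pure_tensor0l (n : N) : pure_tensor (0 : M) n = 0.
Proof. by apply: (addrI (pure_tensor 0 n)); rewrite -pure_tensorDl !addr0. Qed.

Lemma pure_tensor0r (m : M) : pure_tensor m (0 : N) = 0.
Proof. by apply: (addrI (pure_tensor m 0)); rewrite -pure_tensorDr !addr0. Qed.

Lemma pure_tensorBl (m m' : M) (n : N) :
  pure_tensor (m - m') n = pure_tensor m n - pure_tensor m' n.
Proof. by apply: (addIr (pure_tensor m' n)); rewrite -pure_tensorDl !subrK. Qed.

Lemma pure_tensor_suml (I : Type) (r : seq I) (F : I -> M) (n : N) :
  pure_tensor (\sum_(i <- r) F i) n = \sum_(i <- r) pure_tensor (F i) n.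
Proof.
elim: r => [|i r IHr]; first by rewrite !big_nil pure_tensor0l.
by rewrite !big_cons pure_tensorDl IHr.
Qed.

Lemma pure_tensor_sumr (I : Type) (r : seq I) (m : M) (F : I -> N) :
  pure_tensor m (\sum_(i <- r) F i) = \sum_(i <- r) pure_tensor m (F i).
Proof.
elim: r => [|i r IHr]; first by rewrite !big_nil pure_tensor0r.
by rewrite !big_cons pure_tensorDr IHr.
Qed.

Lemma tensor_zmod_ind (P : tensor M N -> Prop) :
    P 0 -> (forall x y, P x -> P y -> P (x - y)) ->
    (forall m n, P (pure_tensor m n)) ->
  forall t, P t.
Proof.
move=> P0 PB P1 t; rewrite -[t]reprK; move: (repr t).
apply: freeg_zmod_ind => [|x y|[m n]]; last exact: P1.
- by rewrite raddf0.
- by rewrite raddfB; exact: PB.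
Qed.

(** Used to draw information from an equality of tensors: it persists under
    each balanced biadditive map. *)
Lemma tensor_universal (V : zmodType) (h : M -> N -> V) :
    (forall m m' n, h (m + m') n = h m n + h m' n) ->
    (forall m n n', h m (n + n') = h m n + h m n') ->
    (forall a m n, h (a *: m) n = h m (a *: n)) ->
  exists F : {additive tensor M N -> V},
    forall m n, F (pure_tensor m n) = h m n.
Proof.
move=> hDl hDr hZ.
(* [fglift] takes values in a module over the coefficients, here int. *)
pose V' : lmodType int := zmodule V.
pose H : {freeg (M * N) / int} -> V' := fglift (fun p => (h p.1 p.2 : V')).
have HB x y : H (x - y) = H x - H y by exact: lift_is_additive.
have H1 m n : H << (m, n) >> = h m n by rewrite /H liftU scale1r.
have HK x : x \in @tensor_kernel_pred R M N -> H x = 0.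
  move=> /set_mem xK; apply: (xK [set y | H y = 0]); split; first split.
  - by apply/mem_set => /=; rewrite -(subrr 0) HB subrr.
  - move=> y z /set_mem /= y0 /set_mem /= z0; apply/mem_set => /=.
    by rewrite HB y0 z0 subr0.
  - move=> y [[[m [m' [n ->]]]|[m [n [n' ->]]]]|[a [m [n ->]]]] /=;
      rewrite !HB !H1.
    + by rewrite hDl -addrA -opprD subrr.
    + by rewrite hDr -addrA -opprD subrr.
    + by rewrite hZ subrr.
have Hpi x : H (repr (\pi_(tensor M N) x)) = H x.
  apply/subr0_eq; rewrite -HB; apply: HK.
  have : repr (\pi_(tensor M N) x) = x %[mod tensor M N] by rewrite reprK.
  by move/eqP; rewrite -Quotient.idealrBE.
have FB : zmod_morphism (fun t : tensor M N => H (repr t)).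
  by move=> x y; rewrite -[x]reprK -[y]reprK -raddfB !Hpi HB.
pose Fm := GRing.isZmodMorphism.Build _ _ _ FB.
pose F : {additive tensor M N -> V} :=
  HB.pack (fun t : tensor M N => H (repr t)) Fm.
by exists F => m n; rewrite /= Hpi H1.
Qed.

End TensorProduct.

Section TensorMapTheory.
Variables (R : comNzRingType) (M N N' : lmodType R) (f : {linear N -> N'}).
Local Notation fM := (@tensor_map R M N N' f).

HB.instance Definition _ :=
  GRing.isZmodMorphism.Build (tensor M N) (tensor M N')
  (@tensor_map R M N N' f) (@tensor_map_is_zmod_morphism R M N N' f).

Lemma tensor_map_null : (forall n, f n = 0) -> forall t, fM t = 0.
Proof.
move=> f0; apply: tensor_zmod_ind => [|x y x0 y0|m n]; first exact: raddf0.
- by rewrite raddfB /= x0 y0 subr0.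
- by rewrite tensor_map_pure f0 pure_tensor0r.
Qed.
End TensorMapTheory.

(** * Submodules and kernels as modules *)

Section Submodule.
Variables (R : comNzRingType) (V : lmodType R).

Definition submod_type (p : submodClosed V) := {x : V | x \in p}.
HB.instance Definition _ p := SubChoice.on (submod_type p).
HB.instance Definition _ p := [SubChoice_isSubLmodule of submod_type p by <:].

Definition submod_incl (p : submodClosed V) : submod_type p -> V := val.

Lemma submod_incl_linear p : linear (@submod_incl p).
Proof. exact: linearP. Qed.
HB.instance Definition _ p :=
  GRing.isLinear.Build R (submod_type p) V _
    (@submod_incl p) (@submod_incl_linear p).
End Submodule.

Section Kernel.
Variables (R : comNzRingType) (U V : lmodType R) (g : {linear U -> V}).
Definition ker_submod : {pred U} := fun x => g x == 0.
Lemma ker_submod_closed : submod_closed ker_submod.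
Proof.
split=> [|a x y /eqP gx /eqP gy]; first by rewrite unfold_in linear0.
by rewrite unfold_in linearP gx gy scaler0 addr0.
Qed.
HB.instance Definition _ :=
  GRing.isSubmodClosed.Build R U ker_submod ker_submod_closed.
End Kernel.

(** * Consequences of faithful flatness *)

Section FaithfullyFlat.
Variables (R : comNzRingType) (M : lmodType R).

Definition smul (P : set R) : set M :=
  smallest [set S | zmod_closed (mem S)]
    [set x | exists s m, P s /\ x = s *: m].

Lemma smul_ind (P : set R) (S : set M) :
    S 0 -> (forall x y, S x -> S y -> S (x - y)) ->
    (forall s m, P s -> S (s *: m)) ->
  smul P `<=` S.
Proof.
move=> S0 SB SP x; apply; split; last by move=> _ [s [m [Ps ->]]]; exact: SP.
split; first exact/mem_set.
by move=> y z /set_mem Sy /set_mem Sz; apply/mem_set/SB.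
Qed.

Lemma smul0 P : smul P 0.
Proof. by move=> S [[]] /set_mem. Qed.

Lemma smulB P x y : smul P x -> smul P y -> smul P (x - y).
Proof.
move=> Px Py S SP; have [[_ SB] _] := SP.
by apply/set_mem/SB; apply/mem_set; [exact: Px | exact: Py].
Qed.

Lemma smul_scale P s m : P s -> smul P (s *: m).
Proof. by move=> Ps S [_]; apply; exists s, m. Qed.

Lemma sub_smul (P Q : set R) : P `<=` Q -> smul P `<=` smul Q.
Proof.
move=> PQ; apply: smul_ind => [|x y|s m Ps]; first exact: smul0.
- by move=> Qx Qy; exact: smulB.
- exact: smul_scale (PQ _ Ps).
Qed.

Hypothesis Mff : faithfully_flat M.

(** If pM = M then M (x) p -> M (x) R -> 0 is exact, because a tensor m (x) n
    equals (n *: m) (x) 1. Faithful flatness reflects this to p -> R -> 0. *)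
Lemma faithfully_flat_proper (p : submodClosed R^o) :
  (forall m, smul [set r | r \in p] m) -> forall r : R, r \in p.
Proof.
move=> Mp r; pose z : {linear R^o -> R^o} := \0.
have: exact_at (@submod_incl R R^o p) z.
  apply/Mff/seteqP; split=> [_ [t _ <-]|t _].
    by rewrite /= tensor_map_null.
  move: t; apply: tensor_zmod_ind => [|x y [u _ <-] [v _ <-]|m n].
  - by exists 0 => //; exact: raddf0.
  - by exists (u - v) => //; rewrite raddfB.
  rewrite -[n]mulr1 -pure_tensorZ; move: (n *: m) => {n}m.
  move: (Mp m); move: m; apply: smul_ind => [|x y [u _ ux] [v _ vy]|s m sp].
  - by exists 0; rewrite ?raddf0 ?pure_tensor0l.
  - by exists (u - v) => //; rewrite raddfB pure_tensorBl -ux -vy.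
  - exists (pure_tensor m (exist _ s sp : submod_type p)) => //.
    by rewrite tensor_map_pure pure_tensorZ [_ *: _]mulr1.
move=> /seteqP[_ /(_ r erefl)[x _ <-]]; exact: (valP x).
Qed.

(** The equational criterion for flatness. With g the linear map v |-> v A, the
    tensor t = \sum_i m i (x) e_i is killed by M (x) g, so flatness makes it
    come from M (x) ker g. Reading off the i-th coordinate of t in both forms
    expresses m i by elements of M and i-th coordinates of elements of ker g. *)
Lemma flat_relations k l (A : 'M[R]_(k, l)) (m : 'I_k -> M) :
    (forall j, \sum_i A i j *: m i = 0) ->
  forall i, smul [set s | exists2 v : 'rV[R]_k, v *m A = 0 & v 0 i = s] (m i).
Proof.
move=> Am i; pose g : {linear 'rV[R]_k -> 'rV[R]_l} := mulmxr A.
have /Mff/seteqP[_ exg] : exact_at (@submod_incl R _ (ker_submod g)) g.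
  apply/seteqP; split=> [_ [[x /= /eqP gx] _ <-]//|x /= gx].
  by exists (exist _ x (introT eqP gx)).
pose t := \sum_i pure_tensor (m i) (delta_mx 0 i : 'rV[R]_k).
have /exg[u _ ut] : tensor_map g t = 0.
  rewrite /t raddf_sum.
  under eq_bigr => i' _.
    rewrite /= tensor_map_pure /= -rowE [row _ _]row_sum_delta pure_tensor_sumr.
    under eq_bigr => j _ do rewrite -pure_tensorZ.
    over.
  rewrite exchange_big big1 //= => j _.
  rewrite -pure_tensor_suml; under eq_bigr do rewrite mxE.
  by rewrite Am pure_tensor0l.
have [F F1] : exists F : {additive tensor M 'rV[R]_k -> M},
    forall m v, F (pure_tensor m v) = v 0 i *: m.
  apply: tensor_universal => [x y v|x v w|a x v].
  - exact: scalerDr.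
  - by rewrite mxE scalerDl.
  - by rewrite mxE mulrC scalerA.
have -> : m i = F t.
  rewrite /t raddf_sum (bigD1 i) //= big1 ?addr0.
    by rewrite F1 mxE !eqxx scale1r.
  by move=> j ji; rewrite F1 mxE eqxx eq_sym (negbTE ji) scale0r.
rewrite -ut; move: u {ut}; apply: tensor_zmod_ind => [|x y Sx Sy|x [v vp]].
- by rewrite !raddf0; exact: smul0.
- by rewrite !raddfB; exact: smulB.
- by rewrite tensor_map_pure F1; apply: smul_scale; exists v => //; exact/eqP.
Qed.

(** Ideals of D arise below as the elements of D lying in a submodule of K,
    hence this form of [faithfully_flat_proper] for sets. *)
Lemma faithfully_flat_unit (P : set R) :
    P 0 -> (forall a x y, P x -> P y -> P (a * x + y)) ->
  (forall m, smul P m) -> P 1.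
Proof.
move=> P0 PD PM; pose q : {pred R^o} := fun r => r \in P.
have q_closed : submod_closed q.
  split=> [|a x y /set_mem Px /set_mem Py]; first exact/mem_set.
  by apply/mem_set/PD.
pose q_mixin := GRing.isSubmodClosed.Build R R^o q q_closed.
pose p : submodClosed R^o := HB.pack q q_mixin.
apply/set_mem; apply: (@faithfully_flat_proper p) => m.
by apply: sub_smul (PM m) => r Pr; apply/mem_set.
Qed.

End FaithfullyFlat.

(** * Submodules of the quotient field and their colons *)

Section Ideals.
Variable D : idomainType.
Local Notation K := {fraction D}.
Local Notation base := (@base_ring D).

Lemma fscaleE (a : D) (x : K) : a *: x = a%:F * x. Proof. by []. Qed.

Lemma submoduleP (A : set K) :
  is_submodule A <-> A 0 /\ forall (a : D) x y, A x -> A y -> A (a *: x + y).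
Proof.
split=> [[/set_mem A0 AD]|[A0 AD]]; split=> //.
- by move=> a x y Ax Ay; apply/set_mem/AD; exact/mem_set.
- exact/mem_set.
- by move=> a x y /set_mem Ax /set_mem Ay; apply/mem_set/AD.
Qed.

Lemma submoduleZ (A : set K) (a : D) x : is_submodule A -> A x -> A (a *: x).
Proof. by move=> /submoduleP[A0 AD] Ax; rewrite -[_ *: _]addr0; exact: AD. Qed.

Lemma gen_is_submodule (X : set K) : is_submodule (gen_submodule X).
Proof.
apply/submoduleP; split=> [A [/submoduleP[]]//|a x y Xx Xy A AX].
have [/submoduleP[_ AD] _] := AX.
by apply: AD; [exact: Xx | exact: Xy].
Qed.

Lemma sub_gen (X : set K) : X `<=` gen_submodule X.
Proof. exact: sub_gen_smallest. Qed.

Lemma gen_sub (X A : set K) :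
  is_submodule A -> X `<=` A -> gen_submodule X `<=` A.
Proof. by move=> Am XA; exact: smallest_sub. Qed.

Lemma base_is_submodule : is_submodule base.
Proof.
apply/submoduleP; split=> [|a _ _ [x _ <-] [y _ <-]].
- by exists 0; rewrite ?tofrac0.
- by exists (a * x + y); rewrite // fscaleE -tofracM -tofracD.
Qed.

Lemma base1 : base 1. Proof. by exists 1; rewrite ?tofrac1. Qed.

Lemma colon_is_submodule (A B : set K) :
  is_submodule A -> is_submodule (colon A B).
Proof.
move=> /submoduleP[A0 AD]; apply/submoduleP; split=> [y _|a x y xB yB z Bz].
- by rewrite mul0r.
- by rewrite mulrDl fscaleE -mulrA; apply: AD; [exact: xB | exact: yB].
Qed.

Lemma colon_anti (A B C : set K) : B `<=` C -> colon A C `<=` colon A B.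
Proof. by move=> BC x xC y /BC; exact: xC. Qed.

Lemma colon_swap (A B C : set K) : B `<=` colon A C -> C `<=` colon A B.
Proof. by move=> BC x Cx y /BC; rewrite mulrC; exact. Qed.

Lemma colon_gen (A X : set K) :
  is_submodule A -> colon A (gen_submodule X) = colon A X.
Proof.
move=> Am; apply/seteqP; split; first exact (colon_anti (@sub_gen X)).
apply: colon_swap; apply: gen_sub; first exact: colon_is_submodule.
by apply: colon_swap => x.
Qed.

Lemma v_closure_ext (A : set K) : A `<=` v_closure A.
Proof. by apply: colon_swap => x. Qed.

Lemma v_closure_mono (A B : set K) : A `<=` B -> v_closure A `<=` v_closure B.
Proof. by move=> AB; exact (colon_anti (colon_anti AB)). Qed.

Lemma v_closure_min (A B : set K) :
  A `<=` v_closure B -> v_closure A `<=` v_closure B.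
Proof. by move=> AB; apply: colon_anti; exact (colon_swap AB). Qed.

Lemma v_closure_gen (X : set K) : v_closure (gen_submodule X) = v_closure X.
Proof. by rewrite /v_closure colon_gen //; exact: base_is_submodule. Qed.

Lemma v_closure_is_submodule (A : set K) : is_submodule (v_closure A).
Proof. exact/colon_is_submodule/base_is_submodule. Qed.

Lemma v_closure_base (A : set K) : A `<=` base -> v_closure A `<=` base.
Proof.
move=> Ab x vx; rewrite -[x]mulr1; apply: vx => y /Ab.
by rewrite mul1r.
Qed.

(** * The t-operation and t-maximal ideals *)

(** The t-operation read off from finite sets of generators. It makes sense for
    any set X, so that unions, in particular unions of chains, can be fed to
    it directly; [t_closureE] compares it with [t_closure]. *)
Definition t_span (X : set K) : set K := [set z | exists Y : set K,
  [/\ finite_set Y, Y `<=` X, (exists2 y, Y y & y != 0) & v_closure Y z]].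

Lemma t_closureE (A : set K) : is_submodule A -> t_closure A = t_span A.
Proof.
move=> Am; apply/seteqP; split=> z.
- move=> [J [[Y Yfin ->] J0 JA]]; rewrite v_closure_gen => vz.
  exists Y; split=> //.
    exact: subset_trans (@sub_gen Y) JA.
  apply: contra_notP J0 => Y0; apply/seteqP; split=> [|_ ->]; last first.
    by have [] := (submoduleP _).1 (gen_is_submodule Y).
  apply: gen_sub => [|y Yy]; first apply/submoduleP; first split=> //.
    by move=> a _ _ -> ->; rewrite scaler0 addr0.
  by apply: contrapT => /eqP y0; apply: Y0; exists y.
- move=> [Y [Yfin YA [y Yy y0] vz]]; exists (gen_submodule Y).
    split; [by exists Y | | exact: gen_sub].
    move=> gY; have : gen_submodule Y y by exact: sub_gen.
    by rewrite gY => /eqP; exact/negP.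
  by rewrite v_closure_gen.
Qed.

Lemma t_span_mono (X X' : set K) : X `<=` X' -> t_span X `<=` t_span X'.
Proof.
move=> XX' z [Y [Yfin YX Y0 vz]]; exists Y; split=> //.
exact: subset_trans XX'.
Qed.

Lemma finite_set_seq_ind (T : eqType) (P : set T -> Prop) :
    P set0 -> (forall x A, P A -> P (x |` A)) ->
  forall A, finite_set A -> P A.
Proof.
move=> P0 PU A /finite_seqP[s ->]; elim: s => [|x s Ps].
  by rewrite set_nil.
rewrite (_ : [set` x :: s] = x |` [set` s]); first exact: PU.
apply/seteqP; split=> y /=; rewrite inE.
  by move=> /orP[/eqP|]; [left|right].
by move=> [->|->]; rewrite ?eqxx ?orbT.
Qed.

Section NonzeroElement.
Variables (X : set K) (c : K).
Hypotheses (Xc : X c) (c0 : c != 0).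

Lemma t_span_ext : X `<=` t_span X.
Proof.
move=> x Xx; exists [set c; x]; split.
- exact: finite_set2.
- by move=> _ [->|->].
- by exists c => //; left.
- by apply: v_closure_ext; right.
Qed.

(** The finite sets that serve the individual elements of F can be united, and
    c serves when F is empty. *)
Lemma t_span_finite (F : set K) : finite_set F -> F `<=` t_span X ->
  exists Y, [/\ finite_set Y, Y `<=` X, (exists2 y, Y y & y != 0)
    & F `<=` v_closure Y].
Proof.
move: F; apply: finite_set_seq_ind => [_|x F IH FX].
  exists [set c]; split=> //; first by move=> x ->.
  by exists c.
have [Y [Yfin YX [y Yy y0] FY]] : _ := IH (subset_trans (@subsetUr _ _ _) FX).
have [Z [Zfin ZX _ Zx]] := FX x (or_introl erefl).
exists (Y `|` Z); split.
- by rewrite finite_setU.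
- by rewrite subUset.
- by exists y => //; left.
- move=> x' [->|/FY vx'].
  + exact (v_closure_mono (@subsetUr _ Y Z) Zx).
  + exact (v_closure_mono (@subsetUl _ Y Z) vx').
Qed.

Lemma t_span_idem : t_span (t_span X) `<=` t_span X.
Proof.
move=> z [F [Ffin FX _ vz]]; have [Y [Yfin YX Y0 FY]] := t_span_finite Ffin FX.
by exists Y; split=> //; exact: v_closure_min vz.
Qed.

Lemma t_span_is_submodule : is_submodule (t_span X).
Proof.
apply/submoduleP; split=> [|a x y Xx Xy].
  exists [set c]; split=> //; [by move=> x ->|by exists c|].
  by have [] := (submoduleP _).1 (v_closure_is_submodule [set c]).
have [] := @t_span_finite [set x; y]; first exact: finite_set2.
  by move=> _ [->|->].
move=> Y [Yfin YX Y0 xyY]; exists Y; split=> //.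
have [_ vD] := (submoduleP _).1 (v_closure_is_submodule Y).
by apply: (vD a x y); apply: xyY; [left|right].
Qed.

End NonzeroElement.

Lemma t_span_base (X : set K) : X `<=` base -> t_span X `<=` base.
Proof.
move=> Xb z [Y [_ YX _ vz]]; apply: v_closure_base vz.
exact: subset_trans YX Xb.
Qed.

Lemma submodule_base1 (A : set K) : is_submodule A -> A 1 -> base `<=` A.
Proof. by move=> Am A1 _ [r _ <-]; rewrite -[_%:F]mulr1; exact: submoduleZ. Qed.

Lemma integral_is_frac_ideal (A : set K) :
  is_submodule A -> A `<=` base -> is_frac_ideal A.
Proof.
move=> Am Ab; split=> //; exists 1; first exact: oner_neq0.
by move=> x /Ab; rewrite scale1r.
Qed.

(** The case X = set0 is needed for the empty chain. *)
Lemma chain_finite (T : eqType) (F : set (set T)) (A Y : set T) :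
    total_on F subset -> finite_set Y -> Y `<=` A `|` \bigcup_(X in F) X ->
  exists2 X, F X \/ X = set0 & Y `<=` A `|` X.
Proof.
move=> Ftot; move: Y; apply: finite_set_seq_ind => [_|x Y IH xY].
  by exists set0; [right | move=> ? []].
have [X FX YX] : _ := IH (subset_trans (@subsetUr _ _ _) xY).
have [Ax|[X' FX' X'x]] := xY x (or_introl erefl).
  by exists X => // y [->|/YX//]; left.
have [XX'|X'X] : X `<=` X' \/ X' `<=` X.
- by case: FX => [FX|->]; [exact: Ftot | left].
- exists X'; first by left.
  by move=> y [->|/YX[|/XX']]; [right|left|right].
- by exists X => // y [->|/YX//]; right; exact: X'X.
Qed.

(** Zorn's lemma on the sets X of elements of D such that 1 is not in the
    t-span of A and X: whether 1 is in a t-span depends on finite subsets only,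
    so this passes to unions of chains. A maximal X equals the t-span of A and
    X, as the t-span is idempotent. *)
Lemma t_maximal_exists (A : set K) (c : K) :
    A c -> c != 0 -> A `<=` base -> ~ t_span A 1 ->
  exists2 M, t_maximal M & A `<=` M.
Proof.
move=> Ac c0 Ab A1; pose P (X : set K) := X `<=` base /\ ~ t_span (A `|` X) 1.
have [F FP Ftot|M0 [[M0b M01] M0max]] := @Zorn_bigcup K P.
  split; first by move=> x [X /FP[Xb _]]; exact: Xb.
  move=> [Y [Yfin YF Y0 vY]].
  have [X XF YX] := chain_finite Ftot Yfin YF.
  have : t_span (A `|` X) 1 by exists Y.
  by case: XF => [/FP[]//|->]; rewrite setU0.
have AM0c : (A `|` M0) c by left.
pose M := t_span (A `|` M0).
have AM : A `<=` M.
  by apply (subset_trans (@subsetUl _ A M0) (t_span_ext AM0c c0)).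
have M0M : M0 `<=` M.
  by apply (subset_trans (@subsetUr _ A M0) (t_span_ext AM0c c0)).
have maxM N : M `<=` N -> P N -> N = M.
  move=> MN PN; apply/seteqP; split=> // x Nx; apply: (M0M).
  apply: contrapT => M0x.
  apply: M0max PN; split; first exact: subset_trans M0M MN.
  by move=> /(_ x Nx).
have Mm : is_submodule M := t_span_is_submodule AM0c c0.
have Mb : M `<=` base by apply: t_span_base; rewrite subUset.
exists M => //; split; first split; first split.
- exact: integral_is_frac_ideal.
- by move=> M_0; move: (AM c Ac); rewrite M_0 => /eqP; exact/negP.
- rewrite t_closureE //; apply/seteqP; split.
    exact (t_span_ext (AM _ Ac) c0).
  exact (t_span_idem AM0c c0).
- by split=> // /(_ 1 base1).
- move=> N [[[Nm _] _ Nt] [Nb Nb']] MN; apply: maxM => //; split=> // N1.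
  apply: Nb'; apply: submodule_base1 => //; rewrite Nt t_closureE //.
  apply: t_span_mono N1; rewrite subUset; split=> //.
  exact (subset_trans AM MN).
Qed.

Lemma v_closure_principal (a : D) (Y : set K) : a != 0 ->
  Y `<=` [set x | exists r : D, x = (r * a)%:F] ->
  v_closure Y `<=` [set x | exists r : D, x = (r * a)%:F].
Proof.
move=> a0 Ya z; have a0F : a%:F != 0 by rewrite tofrac_eq0.
move=> /(_ (a%:F^-1))[|r _ rE]; last by exists r; rewrite tofracM rE mulfVK.
by move=> y /Ya[r ->]; exists r => //; rewrite mulrC tofracM mulfK.
Qed.

Lemma principal_proper_t_ideal (a : D) : a != 0 -> a \isn't a GRing.unit ->
  proper_t_ideal [set x : K | exists r : D, x = (r * a)%:F].
Proof.
move=> a0 aU; set A := [set x | _].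
have Am : is_submodule A.
  apply/submoduleP; split=> [|b _ _ [r ->] [s ->]].
  - by exists 0; rewrite mul0r tofrac0.
  - by exists (b * r + s); rewrite mulrDl tofracD fscaleE -tofracM mulrA.
have Aa : A a%:F by exists 1; rewrite mul1r.
have a0F : a%:F != 0 by rewrite tofrac_eq0.
have Ab : A `<=` base by move=> _ [r ->]; exists (r * a).
split; first split; first exact: integral_is_frac_ideal.
- by move=> A0; move: Aa; rewrite A0 => /eqP; exact/negP.
- rewrite t_closureE//; apply/seteqP; split; first exact (t_span_ext Aa a0F).
  by move=> z [Y [_ YA _]]; exact: v_closure_principal.
- split=> // /(_ 1 base1)[r /eqP]; rewrite -tofrac1 tofrac_eq => /eqP r1.
  by move/negP: aU; apply; apply/unitrPr; exists r; rewrite mulrC.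
Qed.

(** * Faithfully flat ideals *)

Lemma ideal_valD (I : frac_ideal D) (x y : ideal_module I) :
  val (x + y) = val x + val y.
Proof. by []. Qed.

Lemma ideal_valZ (I : frac_ideal D) (a : D) (x : ideal_module I) :
  val (a *: x) = a *: val x.
Proof. by []. Qed.

(** Apply [flat_relations] to the system x_j T_0 - a T_j = 0 in I, which has
    the solution T_0 = a, T_j = x_j. A solution s, t_1, ... of it in D means
    that s x_j = t_j a for all j. *)
Lemma flat_colon (I : frac_ideal D) (X : set K) (a : ideal_module I) :
    faithfully_flat (ideal_module I) -> finite_set X -> X `<=` I ->
  smul [set s : D | forall x, X x -> exists t : D, s *: x = t *: val a] a.
Proof.
move=> Iff /finite_seqP[s ->] sI.
have [_ [d d0 dI]] := ideal_setP I.
have sP (i : 'I_(size s)) : s`_i \in ideal_pred I.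
  by apply/mem_set/sI => /=; exact: mem_nth.
pose b i : ideal_module I :=
  exist (fun x => x \in ideal_pred I) _ (sP i).
(* The coefficients of the system must be in D, hence the factor d. *)
have clr (x : ideal_module I) : exists r : D, r%:F = d *: val x.
  by have [r _ <-] := dI _ (set_mem (valP x)); exists r.
have [a' a'E] := clr a.
have [b' b'E] := choice (fun i => clr (b i)).
pose A : 'M[D]_(1 + size s, size s) := col_mx (\row_j b' j) (- a'%:M).
pose m (i : 'I_(1 + size s)) : ideal_module I :=
  match split i with inl _ => a | inr j => b j end.
have mr0 : m (lshift _ 0) = a by rewrite /m (unsplitK (inl _)).
have Am j : \sum_i A i j *: m i = 0.
  rewrite big_split_ord big_ord1 /= mr0 (bigD1 j) //= big1 => [|i ij].
    rewrite addr0 /A col_mxEu col_mxEd /m (unsplitK (inr _)) !mxE eqxx mulr1n.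
    apply: val_inj; rewrite ideal_valD !ideal_valZ scaleNr !fscaleE.
    by rewrite b'E a'E !fscaleE mulrAC subrr.
  rewrite /A col_mxEd !mxE (negbTE ij) oppr0 scale0r //.
have := flat_relations Iff Am (i := lshift _ 0).
rewrite mr0; apply: sub_smul => _ [v vA <-] x /= /(nthP 0)[j js <-].
have vE :
    v 0 (lshift _ ord0) * b' (Ordinal js) = a' * v 0 (rshift 1 (Ordinal js)).
  have /rowP/(_ (Ordinal js)) := vA.
  rewrite -{1}[v]hsubmxK mul_row_col mulmxN mul_mx_scalar !mxE big_ord1 !mxE.
  exact: subr0_eq.
exists (v 0 (rshift _ (Ordinal js))).
have d0F : d%:F != 0 by rewrite tofrac_eq0.
have /= bE := b'E (Ordinal js).
apply: (mulfI d0F); rewrite -!fscaleE !scalerA mulrC [d * _]mulrC -!scalerA.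
by rewrite -bE -a'E !fscaleE -!tofracM vE mulrC.
Qed.

Lemma gen_colon (X : set K) z w :
  colon base X z -> gen_submodule X w -> base (z * w).
Proof. by rewrite -(colon_gen _ base_is_submodule) => zX; exact: zX. Qed.

Lemma t_maximal_proper (M : set K) : t_maximal M ->
  is_submodule M /\ ~ M 1.
Proof.
move=> [[[[Mm _] _ _] [_ Mb]] _]; split=> // M1.
by apply: Mb; exact: submodule_base1.
Qed.

Section Main.
Variable I : frac_ideal D.
Hypothesis Iff : faithfully_flat (ideal_module I).

Lemma faithfully_flat_base (N : set K) : is_submodule N ->
  (forall m : ideal_module I, smul [set r : D | N r%:F] m) -> N 1.
Proof.
move=> /submoduleP[N0 ND] IN; rewrite -tofrac1.
apply: (@faithfully_flat_unit D _ Iff [set r : D | N r%:F]) =>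
  [|r x y Nx Ny|//].
  by rewrite /= tofrac0.
by rewrite /= tofracD tofracM; exact: ND.
Qed.

(** Otherwise, by [flat_colon] for singletons, each element of I lies in MI. *)
Lemma locally_principal (M : set K) : is_submodule M -> ~ M 1 ->
  exists2 a, ideal_set I a & forall y, ideal_set I y ->
    exists s : D, ~ M s%:F /\ exists t : D, s *: y = t *: a.
Proof.
move=> Mm M1; apply: contrapT => noa; apply: M1.
apply: faithfully_flat_base => // m; apply: contrapT => mM; apply: noa.
exists (val m) => [|y Iy]; first exact: set_mem (valP m).
apply: contrapT => nos; apply: mM.
have yI : [set y] `<=` I by move=> _ ->.
apply: sub_smul (flat_colon Iff (finite_set1 y) yI) => s /(_ y erefl) sy.
by apply: contrapT => Ms; apply: nos; exists s.
Qed.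

Lemma ideal_nonzero : exists2 x, ideal_set I x & x != 0.
Proof.
apply: contrapT => I0; have : [set (0 : K)] 1.
  apply: faithfully_flat_base => [|m].
    apply/submoduleP; split=> // a _ _ -> ->; by rewrite scaler0 addr0.
  rewrite (_ : m = 0); first exact: smul0.
  apply: val_inj; apply: contrapT => /eqP m0; apply: I0.
  by exists (val m) => //; exact: set_mem (valP m).
by move=> /= /eqP; rewrite oner_eq0.
Qed.

(** X generates a submodule of I that agrees with I locally at each t-maximal
    ideal; the t-operation cannot tell them apart, so neither can (D : -). *)
Lemma colon_finite : t_finite_character D ->
  exists X, [/\ finite_set X, X `<=` I & colon base X `<=` colon base I].
Proof.
move=> hD; have [x Ix x0] := ideal_nonzero.
have [_ [d d0 dI]] := ideal_setP I.
have [e _ eE] := dI _ Ix.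
have e0 : e != 0.
  by rewrite -tofrac_eq0 eE mulf_neq0// tofrac_eq0.
pose TM := [set M | t_maximal M /\ M e%:F].
(* If e is a unit then eD is not proper, but no t-maximal ideal contains e. *)
have TMfin : finite_set TM.
  have [eU|eU] := boolP (e \is a GRing.unit).
    apply: sub_finite_set (finite_set0 _) => M [/t_maximal_proper[Mm M1] Me].
    apply: M1; rewrite -tofrac1 -(mulVr eU) tofracM -fscaleE.
    exact: submoduleZ.
  apply: sub_finite_set (hD _ (principal_proper_t_ideal e0 eU)).
  move=> M [Mt Me]; split=> // _ [r ->].
  rewrite tofracM -fscaleE; apply: submoduleZ => //.
  by have [] := t_maximal_proper Mt.
have /choice[a aP] : forall M, exists a, t_maximal M ->
    ideal_set I a /\ forall y, ideal_set I y ->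
    exists s : D, ~ M s%:F /\ exists t : D, s *: y = t *: a.
  move=> M; have [Mt|] := pselect (t_maximal M); last by exists 0.
  have [Mm M1] := t_maximal_proper Mt.
  by have [a Ia aM] := locally_principal Mm M1; exists a.
pose X := x |` a @` TM.
exists X; split.
- by rewrite finite_setU; split; [exact: finite_set1|exact: finite_image].
- by move=> _ [->//|[M [Mt _] <-]]; have [] := aP _ Mt.
(* A is the ideal (J : y) of the elements of D that multiply y into the module
   J generated by X. *)
move=> z zX y Iy; pose A := base `&` [set k | gen_submodule X (k * y)].
have gXm := gen_is_submodule X.
(* e y = (d x) y = (d y) x, and d y is in D. *)
have Ae : A e%:F.
  split; first by exists e.
  have [f _ fE] := dI _ Iy.
  rewrite /= eE fscaleE mulrAC -fscaleE -fE -fscaleE; apply: (submoduleZ f gXm).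
  by apply: sub_gen; left.
have [A1|A1] := pselect (t_span A 1).
  (* For k in Y, k (z y) = z (k y) is in D, so z y is in (D : Y), and
     1 in Y_v gives 1 (z y) in D. *)
  have [Y [_ YA _ vY]] := A1; rewrite -[z * y]mul1r.
  apply: vY => k /YA[_ /= ky].
  by rewrite -mulrA [y * k]mulrC; exact: gen_colon zX ky.
have e0F : e%:F != 0 by rewrite tofrac_eq0.
have Ab : A `<=` base by move=> k [].
have [M Mt AM] := t_maximal_exists Ae e0F Ab A1.
have [_ /(_ y Iy)[s [Ms [t st]]]] := aP _ Mt.
case: Ms; apply: (AM); split; first by exists s.
rewrite /= -fscaleE st; apply: (submoduleZ t gXm); apply: sub_gen.
by right; exists M => //; split=> //; exact: AM.
Qed.

End Main.

End Ideals.

Theorem proposition1p13 (D : idomainType) (hD : t_finite_character D)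
    (I : frac_ideal D) :
  faithfully_flat (ideal_module I) -> invertible I.
Proof.
move=> Iff; have [X [Xfin XI Xcolon]] := colon_finite Iff hD.
apply/seteqP; split.
  apply: gen_sub; first exact: base_is_submodule.
  by move=> _ [a [b [Ia bI ->]]]; rewrite mulrC; exact: bI.
apply: submodule_base1; first exact: gen_is_submodule.
apply: (faithfully_flat_base Iff) => [|m]; first exact: gen_is_submodule.
have [m0|m0] := eqVneq (val m) 0.
  by rewrite (_ : m = 0); [exact: smul0 | exact: val_inj].
apply: sub_smul (flat_colon Iff Xfin XI) => s sX; apply: sub_gen.
(* s is the product of m, in I, and of s / m, in (D : X) = (D : I). *)
exists (val m), (s%:F / val m); split; first exact: set_mem (valP m).
- apply: Xcolon => x /sX[t tE]; exists t => //.
  by rewrite mulrAC -fscaleE tE mulfK.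
- by rewrite mulrCA mulfV ?mulr1.
Qed.
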